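(* Let $D\subseteq X$ be nonempty and $\tau_X$-open, let $T_1,T_2:D\to Y$ be single-valued mappings, let $\bar x\in D$, $v\in X\setminus\{\theta_X\}$, and let $a_1,a_2$ be scalars. Suppose that both $T_1$ and $T_2$ are Gâteaux directionally differentiable at $\bar x$ along direction $v$. Then $a_1T_1+a_2T_2$ is Gâteaux directionally differentiable at $\bar x$ along direction $v$ and $(a_1T_1+a_2T_2)'(\bar x,v)=a_1T_1'(\bar x,v)+a_2T_2'(\bar x,v)$. Furthermore, if both $T_1$ and $T_2$ are Gâteaux differentiable at $\bar x$, then $a_1T_1+a_2T_2$ is Gâteaux differentiable at $\bar x$ and $(a_1T_1+a_2T_2)'(\bar x)(v)=a_1T_1'(\bar x)(v)+a_2T_2'(\bar x)(v)$ for every $v\in X\setminus\{\theta_X\}$.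
   Context: An $F$-seminorm on a real vector space $Y$ is a map $q:Y\to[0,\infty)$ with $q(x+y)\le q(x)+q(y)$; $q(ay)\le q(y)$ for all scalars $|a|\le 1$; and $q(a_ny)\to0$ for every $y$ and every sequence of positive numbers $a_n\to0$. It is positive if not identically $0$. A topology $\tau_Y$ is induced by a family $\mathbb{F}_Y$ of $F$-seminorms if for every $y_0\in Y$ the sets $\{y:\max\{q(y-y_0):q\in J\}<\lambda\}$, with $J\subseteq\mathbb{F}_Y$ nonempty finite and $\lambda>0$, form a base of $\tau_Y$-open neighborhoods of $y_0$. $\mathcal{F}_Y$ is the collection of nonempty finite subsets of $\mathbb{F}_Y$. $(X,\tau_X)$ and $(Y,\tau_Y)$ are real Hausdorff topological vector spaces with origins $\theta_X,\theta_Y$, and $\tau_Y$ is induced by a family $\mathbb{F}_Y$ of positive $F$-seminorms. $T:D\to Y$ is Gâteaux directionally differentiable at $\bar x\in D$ along $v\in X\setminus\{\theta_X\}$ with derivative $T'(\bar x,v)\in Y$ if for every $J\in\mathcal{F}_Y$ and $\varepsilon>0$ there is $\delta>0$ (with $\bar x+tv\in D$ for $|t|<\delta$) such that $0<|t|<\delta$ implies $\max\left\{q\left(\frac{T(\bar x+tv)-T(\bar x)-tT'(\bar x,v)}{t}\right):q\in J\right\}<\varepsilon$. $T$ is Gâteaux differentiable at $\bar x$ if this holds along every $v\in X\setminus\{\theta_X\}$, and then $T'(\bar x)(v):=T'(\bar x,v)$. *)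

(* Defs.v *)
From HB Require Import structures.
From mathcomp Require Import all_boot all_order all_algebra finmap.
From mathcomp Require Import boolp classical_sets functions reals topology.
From mathcomp Require Import normedtype sequences.

Set Implicit Arguments.
Unset Strict Implicit.
Unset Printing Implicit Defensive.

Import Order.TTheory GRing.Theory Num.Theory.
Import numFieldTopology.Exports.

Local Open Scope classical_set_scope.
Local Open Scope ring_scope.

Definition F_seminorm (R : realType) (Y : lmodType R) (q : Y -> R) : Prop :=
  [/\ forall y, 0 <= q y,
      forall x y, q (x + y) <= q x + q y,
      forall (a : R) y, `|a| <= 1 -> q (a *: y) <= q y
    & forall y (a : nat -> R), (forall n, 0 < a n) ->
        a n @[n --> \oo] --> (0 : R) -> q (a n *: y) @[n --> \oo] --> (0 : R)].

Definition positive_F_seminorm (R : realType) (Y : lmodType R) (q : Y -> R) :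
  Prop := F_seminorm q /\ exists y, q y != 0.

Definition finite_subfamily (R : realType) (Y : lmodType R)
    (F : set (Y -> R)) (J : {fset Y -> R}) : Prop :=
  J != fset0 /\ [set` J] `<=` F.

(* The default value 0 does not affect the maximum: J is nonempty and its     *)
(* members are nonnegative wherever this is used.                             *)
Definition max_F_seminorm (R : realType) (Y : lmodType R)
    (J : {fset Y -> R}) (y : Y) : R :=
  \big[Order.max/0]_(q <- J) q y.

Definition F_ball (R : realType) (Y : lmodType R)
    (J : {fset Y -> R}) (y0 : Y) (lambda : R) : set Y :=
  [set y | max_F_seminorm J (y - y0) < lambda].

Definition topology_induced_by (R : realType) (Y : topologicalLmodType R)
    (F : set (Y -> R)) : Prop :=
  forall y0 : Y,
    (forall J lambda, finite_subfamily F J -> 0 < lambda ->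
       open_nbhs y0 (F_ball J y0 lambda)) /\
    (forall U, nbhs y0 U -> exists J lambda,
       [/\ finite_subfamily F J, 0 < lambda & F_ball J y0 lambda `<=` U]).

(* A mapping T : D -> Y is represented by a total function X -> Y together    *)
(* with D; its values outside D are never used.                               *)
Section Gateaux.
Variables (R : realType) (X Y : topologicalLmodType R) (F : set (Y -> R)).
Variables (D : set X) (T : X -> Y) (x : X).

Definition is_gateaux_dir_derivative (v : X) (y : Y) : Prop :=
  forall (J : {fset Y -> R}) (eps : R), finite_subfamily F J -> 0 < eps ->
    exists2 delta : R, 0 < delta &
      (forall t : R, `|t| < delta -> D (x + t *: v)) /\
      (forall t : R, 0 < `|t| < delta ->
         max_F_seminorm J (t^-1 *: (T (x + t *: v) - T x - t *: y)) < eps).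

Definition gateaux_dir_differentiable (v : X) : Prop :=
  exists y : Y, is_gateaux_dir_derivative v y.

(* T'(x, v), with the value 0 if there is no derivative; it is unique since   *)
(* Y is Hausdorff.                                                            *)
Definition gateaux_dir_derivative (v : X) : Y :=
  xget 0 [set y | is_gateaux_dir_derivative v y].

Definition gateaux_differentiable : Prop :=
  forall v : X, v != 0 -> gateaux_dir_differentiable v.

(* T'(x), meaningful on the nonzero vectors.                                  *)
Definition gateaux_derivative : X -> Y := fun v => gateaux_dir_derivative v.

End Gateaux.

(* Main.v *)
Require Import Defs.
From mathcomp Require Import all_boot all_order all_algebra finmap.
From mathcomp Require Import boolp classical_sets functions reals topology.
From mathcomp Require Import normedtype sequences.

Set Implicit Arguments.
Unset Strict Implicit.
Unset Printing Implicit Defensive.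

Import Order.TTheory GRing.Theory Num.Theory.
Import numFieldTopology.Exports.

Local Open Scope classical_set_scope.
Local Open Scope ring_scope.

(** The remainder quotient of [a1 *: T1 + a2 *: T2] is [a1 *: z1 + a2 *: z2], with [z1], [z2] those
    of [T1], [T2]. For an integer [n] bounding both moduli, each F-seminorm of it is at most
    [n * q z1 + n * q z2] by subadditivity and [F_seminormZ_nat], hence small with [z1] and [z2].
    The formula for the derivative then needs uniqueness, which holds because [Y] is Hausdorff with
    topology induced by [F]. *)

Lemma max_F_seminorm_ltP (R : realType) (Y : lmodType R) (J : {fset Y -> R})
    (y : Y) (e : R) : 0 < e ->
  max_F_seminorm J y < e <-> (forall q, q \in J -> q y < e).
Proof.
move=> e0; rewrite /max_F_seminorm; split => [lt_e q qJ|lt_e].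
  by apply: le_lt_trans lt_e; exact: le_bigmax_seq.
(* [0 < e] takes care of the default value [0] of the maximum. *)
by rewrite big_seq; apply: (big_ind (fun z => z < e)) => // a b ae be;
  rewrite gt_max ae.
Qed.

(** The limit axiom at the vector [0]: along the harmonic sequence the values are constantly [q 0],
    yet they tend to [0]. *)
Lemma F_seminorm0 (R : realType) (Y : lmodType R) (q : Y -> R) :
  F_seminorm q -> q 0 = 0.
Proof.
move=> [_ _ _ /(_ 0 _ _ (@cvg_harmonic R))].
have -> : (fun n => q (@harmonic R n *: 0)) = cst (q 0).
  by apply/funext => n; rewrite scaler0.
move=> /(_ (fun n => harmonic_gt0 n)) q0.
exact: (cvg_unique (@Rhausdorff R) (cvg_cst _) q0).
Qed.

(* An F-seminorm is not homogeneous: scalars of modulus above 1 are controlled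
   through an integer bound and subadditivity. *)
Lemma F_seminormZ_nat (R : realType) (Y : lmodType R) (q : Y -> R) (a : R)
    (n : nat) (y : Y) :
  F_seminorm q -> `|a| <= n%:R -> q (a *: y) <= n%:R * q y.
Proof.
move=> Fq an; have q0 := F_seminorm0 Fq; case: Fq => q_ge0 qD qZ _.
have qMn k : q (y *+ k) <= k%:R * q y.
  elim: k => [|k IH]; first by rewrite mulr0n q0 mul0r.
  by rewrite mulrSr -natr1 mulrDl mul1r (le_trans (qD _ _)) // lerD2r.
case: n => [|n] in an *.
  by move: an; rewrite normr_le0 => /eqP ->; rewrite scale0r q0 mul0r.
have n0 : n.+1%:R != 0 :> R by rewrite pnatr_eq0.
(* The factor [a / n.+1%:R] has modulus at most 1, so [qZ] applies to it. *)
have -> : a *: y = (a / n.+1%:R) *: (y *+ n.+1).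
  by rewrite -scaler_nat scalerA divfK.
apply: le_trans (qMn _); apply: qZ.
by rewrite normrM normfV normr_nat ler_pdivrMr ?ltr0n// mul1r.
Qed.

(** Stated for the relation, not for the chosen derivative, so that uniqueness can be deduced from
    it. *)
Lemma is_gateaux_dir_derivative_lincomb (R : realType)
    (X Y : topologicalLmodType R) (F : set (Y -> R)) (D : set X)
    (T1 T2 : X -> Y) (x v : X) (y1 y2 : Y) (a1 a2 : R) :
  (forall q, F q -> F_seminorm q) ->
  is_gateaux_dir_derivative F D T1 x v y1 ->
  is_gateaux_dir_derivative F D T2 x v y2 ->
  is_gateaux_dir_derivative F D (fun z => a1 *: T1 z + a2 *: T2 z) x v
    (a1 *: y1 + a2 *: y2).
Proof.
move=> Fq dT1 dT2 J e FJ e0.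
(* The successor keeps [n] positive even when [a1 = a2 = 0], so that [r] below can divide by it; [r]
   is chosen so that [n * r + n * r = e]. *)
pose n := (Num.truncn (`|a1| + `|a2|)).+1.
have an : `|a1| + `|a2| <= n%:R by exact/ltW/truncnS_gt.
have a1n : `|a1| <= n%:R by apply: le_trans an; rewrite lerDl.
have a2n : `|a2| <= n%:R by apply: le_trans an; rewrite lerDr.
have n0 : 0 < n%:R :> R by rewrite ltr0n.
pose r := e / 2 / n%:R.
have r0 : 0 < r by rewrite !divr_gt0.
have [d1 d10 [Dd1 Td1]] := dT1 J r FJ r0.
have [d2 d20 [_ Td2]] := dT2 J r FJ r0.
exists (Num.min d1 d2); first by rewrite lt_min d10.
split=> [t|t]; rewrite lt_min; first by move=> /andP[/Dd1].
move=> /and3P[t0 td1 td2].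
have /(max_F_seminorm_ltP _ _ r0) J1 := Td1 t (introT andP (conj t0 td1)).
have /(max_F_seminorm_ltP _ _ r0) J2 := Td2 t (introT andP (conj t0 td2)).
apply/max_F_seminorm_ltP => // q qJ.
have {}Fq : F_seminorm q by apply/Fq/FJ.2.
set z1 := t^-1 *: _ in J1; set z2 := t^-1 *: _ in J2.
have -> : t^-1 *: (a1 *: T1 (x + t *: v) + a2 *: T2 (x + t *: v) -
    (a1 *: T1 x + a2 *: T2 x) - t *: (a1 *: y1 + a2 *: y2)) =
    a1 *: z1 + a2 *: z2.
  rewrite /z1 /z2 !(scalerA a1) !(scalerA a2) !(mulrC _ t^-1) -!scalerA.
  rewrite -scalerDr; congr (_ *: _).
  rewrite !(scalerBr, scalerDr) !(scalerA t) !(mulrC t) -!scalerA !opprD.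
  by rewrite (addrACA (a1 *: _)) (addrACA (a1 *: _ - _)).
apply: le_lt_trans (_ : n%:R * q z1 + n%:R * q z2 < e).
  case: (Fq) => _ qD _ _; apply: le_trans (qD _ _) _.
  by apply: lerD; exact: F_seminormZ_nat.
by rewrite [e]splitr ltrD// mulrC -ltr_pdivlMr //; [exact: J1|exact: J2].
Qed.

Lemma is_gateaux_dir_derivative_unique (R : realType)
    (X Y : topologicalLmodType R) (F : set (Y -> R)) (D : set X)
    (T : X -> Y) (x v : X) (y y' : Y) :
  hausdorff_space Y -> (forall q, F q -> F_seminorm q) ->
  topology_induced_by F ->
  is_gateaux_dir_derivative F D T x v y ->
  is_gateaux_dir_derivative F D T x v y' -> y = y'.
Proof.
(* It suffices that all neighborhoods [A] of [y] and [B] of [y'] meet; [y] itself will lie in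
   both. *)
move=> hausY Fq F_top dy dy'; apply: hausY => A B /nbhs_singleton Ay By'.
exists y; split=> //.
have [J [l [FJ l0 JB]]] := (F_top y').2 B By'; apply: JB.
(* The zero map [T - T] has derivative [y - y'], so [y' - y] itself is the
   difference quotient at every [t <> 0]. *)
have [d d0 [_ /(_ (d / 2))]] :=
  is_gateaux_dir_derivative_lincomb (-1) 1 Fq dy dy' FJ l0.
have d20 : 0 < d / 2 by rewrite divr_gt0.
rewrite gtr0_norm // d20 gtr_pMr // invf_lt1 // ltr1n => /(_ isT).
rewrite !scaleN1r !scale1r !addNr subrr sub0r -scalerN scalerA.
by rewrite mulVf ?gt_eqF// scale1r opprD opprK.
Qed.

Theorem theorem4p6 (R : realType) (X Y : topologicalLmodType R)
    (hausX : hausdorff_space X) (hausY : hausdorff_space Y)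
    (F : set (Y -> R))
    (F_pos : forall q, F q -> positive_F_seminorm q)
    (F_top : topology_induced_by F)
    (D : set X) (D_neq0 : D !=set0) (D_open : open D)
    (T1 T2 : X -> Y) (x : X) (Dx : D x) (a1 a2 : R) :
  (forall v : X, v != 0 ->
     gateaux_dir_differentiable F D T1 x v ->
     gateaux_dir_differentiable F D T2 x v ->
     gateaux_dir_differentiable F D (fun z => a1 *: T1 z + a2 *: T2 z) x v /\
     gateaux_dir_derivative F D (fun z => a1 *: T1 z + a2 *: T2 z) x v =
       a1 *: gateaux_dir_derivative F D T1 x v +
       a2 *: gateaux_dir_derivative F D T2 x v) /\
  (gateaux_differentiable F D T1 x ->
   gateaux_differentiable F D T2 x ->
   gateaux_differentiable F D (fun z => a1 *: T1 z + a2 *: T2 z) x /\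
   forall v : X, v != 0 ->
     gateaux_derivative F D (fun z => a1 *: T1 z + a2 *: T2 z) x v =
       a1 *: gateaux_derivative F D T1 x v +
       a2 *: gateaux_derivative F D T2 x v).
Proof.
have Fq q : F q -> F_seminorm q by move=> /F_pos[].
have main v : gateaux_dir_differentiable F D T1 x v ->
    gateaux_dir_differentiable F D T2 x v ->
    gateaux_dir_differentiable F D (fun z => a1 *: T1 z + a2 *: T2 z) x v /\
    gateaux_dir_derivative F D (fun z => a1 *: T1 z + a2 *: T2 z) x v =
      a1 *: gateaux_dir_derivative F D T1 x v +
      a2 *: gateaux_dir_derivative F D T2 x v.
  (* Existence rules out the default value of [xget]: the chosen values are themselves
     derivatives. *)
  move=> [y1 /(xgetI 0) dT1] [y2 /(xgetI 0) dT2].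
  have dT := is_gateaux_dir_derivative_lincomb a1 a2 Fq dT1 dT2.
  split; first by eexists; exact: dT.
  apply: (is_gateaux_dir_derivative_unique hausY Fq F_top _ dT).
  exact: (xgetI 0 dT).
split=> [v _|dT1 dT2]; first exact: main.
by split=> v v0; have [] := main v (dT1 v v0) (dT2 v v0).
Qed.
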